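(* In the minimizer-free escape rate game with value $\rho$, the following two properties are equivalent: (1) there exists $\alpha\in\mathbb{R}$ such that for all integers $k\geq1$, $S^kd(\cdot,x_0)\leq k\rho+d(\cdot,x_0)+\alpha$ pointwise on $X$; (2) there exists $v\in\mathscr{D}$ such that $Sv\leq\rho+v$ pointwise on $X$.
   Context: A hemi-metric on a nonempty set $X$ is a map $d:X\times X\to\mathbb{R}$ (possibly negative, not necessarily symmetric) such that $d(x,z)\leq d(x,y)+d(y,z)$ for all $x,y,z$, and $d(x,y)=d(y,x)=0$ if and only if $x=y$. The space $X$ carries the topology of the metric $d^\circ(x,y)=\max(d(x,y),d(y,x))$. A self-map $T$ of $X$ is nonexpansive if $d(T(x),T(y))\leq d(x,y)$ for all $x,y$. Minimizer-free escape rate game: $(X,d)$ is a hemi-metric space, $x_0\in X$, $\mathcal{B}$ is a nonempty compact set, and for each $b\in\mathcal{B}$, $T_b:X\to X$ is nonexpansive (player Min has a single action, so plays no role). Standing assumption: for all $x\in X$ the map $b\mapsto T_b(x)$ is continuous, and for every compact $K\subset X$ the set $\{T_b(x)\mid (b,x)\in\mathcal{B}\times K\}$ is compact. Player Max chooses a sequence $b_1,b_2,\dots$ in $\mathcal{B}$ so as to maximize $\limsup_{k\to\infty}d(T_{b_k}\circ\cdots\circ T_{b_1}(x_0),x_0)/k$; the value of the game (the supremum over all sequences) is $\rho=\lim_{k\to\infty}[S^kd(\cdot,x_0)](x_0)/k\in\mathbb{R}$, and it is independent of $x_0$. $\mathrm{Lip}_1$ is the set of functions $v:X\to\mathbb{R}$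 with $v(x)-v(y)\leq d(x,y)$ for all $x,y\in X$. The Shapley operator $S:\mathrm{Lip}_1\to\mathrm{Lip}_1$ is here $Sv(x)=\sup_{b\in\mathcal{B}}v(T_b(x))$. A function $v\in\mathrm{Lip}_1$ is distance-like if there is $\alpha\in\mathbb{R}$ with $v(x)\geq d(x,x_0)+\alpha$ for all $x\in X$ (this does not depend on $x_0$); $\mathscr{D}$ is the set of distance-like functions. *)

(* Defs.v *)
From HB Require Import structures.
From mathcomp Require Import all_boot all_order all_algebra.
From mathcomp Require Import all_classical all_reals all_analysis.

Set Implicit Arguments.
Unset Strict Implicit.
Unset Printing Implicit Defensive.

Import Order.TTheory GRing.Theory Num.Theory.
Import numFieldNormedType.Exports.

Local Open Scope classical_set_scope.
Local Open Scope ring_scope.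

Record hemimetric (R : realType) (X : Type) := Hemimetric {
  hdist :> X -> X -> R;
  hdist_triangle : forall x y z, hdist x z <= hdist x y + hdist y z;
  hdist_eq0 : forall x y, (hdist x y = 0 /\ hdist y x = 0) <-> x = y }.

(* Carrier of the hemi-metric space (X, d): a copy of X, indexed by d so that
   it can be given the topology of the symmetrized metric d°. *)
Definition hemi_space (R : realType) (X : Type) (d : hemimetric R X) : Type := X.

Section HemiSpace.
Context (R : realType) (X : Type) (d : hemimetric R X).

Definition sym_dist (x y : hemi_space d) : R := Num.max (d x y) (d y x).

Lemma hdistxx (x : X) : d x x = 0.
Proof. by have [_ /(_ erefl)[]] := hdist_eq0 d x x. Qed.

Lemma sym_distxx x : sym_dist x x = 0.
Proof. by rewrite /sym_dist hdistxx maxxx. Qed.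

Lemma sym_dist_sym x y : sym_dist x y = sym_dist y x.
Proof. by rewrite /sym_dist maxC. Qed.

Lemma sym_dist_triangle y x z : sym_dist x z <= sym_dist x y + sym_dist y z.
Proof.
rewrite /sym_dist ge_max; apply/andP; split.
  by rewrite (le_trans (hdist_triangle d x y z))// lerD// le_max lexx.
rewrite (le_trans (hdist_triangle d z y x))// addrC.
by rewrite lerD// le_max lexx orbT.
Qed.

Lemma sym_dist_positivity x y : sym_dist x y = 0 -> x = y.
Proof.
move=> xy0; apply/(hdist_eq0 d x y).
have xy : d x y <= 0 by rewrite -xy0 le_max lexx.
have yx : d y x <= 0 by rewrite -xy0 le_max lexx orbT.
have := hdist_triangle d x y x; rewrite hdistxx => xx.
split; apply/eqP; rewrite eq_le ?xy ?yx /=.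
  by rewrite (le_trans xx)// gerDl.
by rewrite (le_trans xx)// gerDr.
Qed.

HB.instance Definition _ := gen_eqMixin (hemi_space d).
HB.instance Definition _ := gen_choiceMixin (hemi_space d).
HB.instance Definition _ := isMetric.Build R (hemi_space d)
  sym_distxx sym_dist_positivity sym_dist_sym sym_dist_triangle.

Definition nonexpansive (f : hemi_space d -> hemi_space d) : Prop :=
  forall x y, d (f x) (f y) <= d x y.

Definition Lip1 : set (hemi_space d -> R) :=
  [set v | forall x y, v x - v y <= d x y].

Definition distance_like (x0 : hemi_space d) : set (hemi_space d -> R) :=
  [set v | Lip1 v /\ exists alpha : R, forall x, d x x0 + alpha <= v x].

Variables (B : Type) (T : B -> hemi_space d -> hemi_space d).

(* [sup] is the supremum in R, with a default value on unbounded sets; for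
   v in Lip1 the supremum below is genuine, see [Lip1_has_sup]. *)
Definition shapley (v : hemi_space d -> R) (x : hemi_space d) : R :=
  sup [set v (T b x) | b in [set: B]].

(* trajectory b x0 k = (T_{b_k} o ... o T_{b_1})(x0), where b_i is [b i.-1]. *)
Fixpoint trajectory (b : nat -> B) (x0 : hemi_space d) (k : nat) :
    hemi_space d :=
  if k is k'.+1 then T (b k') (trajectory b x0 k') else x0.

Definition escape_payoff (x0 : hemi_space d) (b : nat -> B) : \bar R :=
  limn_esup (fun k => (d (trajectory b x0 k) x0 / k%:R)%:E).

Definition game_value (x0 : hemi_space d) : \bar R :=
  ereal_sup [set escape_payoff x0 b | b in [set: nat -> B]].

End HemiSpace.

Arguments Lip1 {R X} d.

(* Sanity checks: under the standing assumptions [shapley] is a self-map of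
   Lip1 and its suprema are finite. *)
Section ShapleyLip1.
Context (R : realType) (X : Type) (d : hemimetric R X).

Lemma dist_Lip1 (x0 : hemi_space d) : Lip1 d (fun x => d x x0).
Proof. by move=> x y; rewrite lerBlDr; exact: hdist_triangle. Qed.

Lemma Lip1_continuous (v : hemi_space d -> R) : Lip1 d v -> continuous v.
Proof.
move=> vL x; apply/(@cvgrPdist_lt _ _ _ (nbhs x)) => e e0.
apply: filterS (nbhsx_ballx x e e0) => y; rewrite ballEmdist => xy.
apply: le_lt_trans xy; rewrite ler_norml; apply/andP; split.
  by rewrite lerNl opprB (le_trans (vL y x))// le_max lexx orbT.
by rewrite (le_trans (vL x y))// le_max lexx.
Qed.

Variables (B : topologicalType) (T : B -> hemi_space d -> hemi_space d).
Hypothesis B_neq0 : [set: B] !=set0.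
Hypothesis B_compact : compact [set: B].
Hypothesis T_nonexp : forall b, nonexpansive (T b).
Hypothesis T_cont : forall x, continuous (fun b => T b x).

Lemma Lip1_has_sup v x : Lip1 d v -> has_sup [set v (T b x) | b in [set: B]].
Proof.
move=> vL; split; first by case: B_neq0 => b _; exists (v (T b x)), b.
have /compact_bounded[M [_ /(_ (M + 1))]] :
    compact [set v (T b x) | b in [set: B]].
  apply: continuous_compact => //; apply: continuous_subspaceT => b.
  by apply: continuous_comp; [exact: T_cont | exact: Lip1_continuous].
rewrite ltrDl ltr01 => /(_ isT) MB.
by exists (M + 1) => r /MB; exact: le_trans (ler_norm _).
Qed.

Lemma shapley_Lip1 v : Lip1 d v -> Lip1 d (shapley T v).
Proof.
move=> vL x y; rewrite lerBlDr; apply: ge_sup.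
  by have [] := Lip1_has_sup x vL.
move=> _ [b _ <-].
have vy : v (T b y) <= shapley T v y.
  by apply: (ub_le_sup (proj2 (Lip1_has_sup y vL))); exists b.
rewrite -lerBlDr (le_trans _ (T_nonexp b x y))// (le_trans _ (vL _ _))//.
by rewrite lerB.
Qed.

End ShapleyLip1.

(* Main.v *)
(* For (1) -> (2), v := sup_(k >= 0) (S^k d(., x0) - k rho): the bound in (1)
   makes it finite, its term k = 0 makes it distance-like, and S - rho shifts
   the family by one index.  For (2) -> (1), S is monotone and commutes with
   constants, so d(., x0) + alpha <= v gives S^k d(., x0) + alpha <= v + k rho,
   and v - v(x0) <= d(., x0). *)
Require Import Defs.
From mathcomp Require Import all_boot all_order all_algebra.
From mathcomp Require Import all_classical all_reals all_analysis.
From mathcomp Require Import lra.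

Set Implicit Arguments.
Unset Strict Implicit.
Unset Printing Implicit Defensive.

Import Order.TTheory GRing.Theory Num.Theory.
Import numFieldNormedType.Exports.

Local Open Scope classical_set_scope.
Local Open Scope ring_scope.

Section ShapleyIteration.
Context (R : realType) (X : Type) (d : hemimetric R X).
Context (B : topologicalType) (T : B -> hemi_space d -> hemi_space d).
Hypothesis B_neq0 : [set: B] !=set0.
Hypothesis B_compact : compact [set: B].
Hypothesis T_nonexp : forall b : B, nonexpansive (T b).
Hypothesis T_cont : forall x : hemi_space d, continuous (fun b : B => T b x).
Implicit Types (v w : hemi_space d -> R) (x : hemi_space d).

Lemma shapley_ub v x b : Lip1 d v -> v (T b x) <= shapley T v x.
Proof.
move=> vL; apply: ub_le_sup; last by exists b.
by have [] := Lip1_has_sup B_neq0 B_compact T_cont x vL.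
Qed.

Lemma shapley_le v x c : (forall b, v (T b x) <= c) -> shapley T v x <= c.
Proof.
move=> vc; apply: ge_sup => [|_ [b _ <-]]; last exact: vc.
by have [b _] := B_neq0; exists (v (T b x)), b.
Qed.

Lemma iter_shapley_Lip1 v k : Lip1 d v -> Lip1 d (iter k (shapley T) v).
Proof.
by move=> vL; elim: k => [//|k IHk]; exact: shapley_Lip1.
Qed.

(** Induction on [k]: the bound on the [k]-th iterate, read at [T b x], involves [v (T b x)], which
    is at most [shapley T v x], hence at most [rho + v x]. Each application of the operator thus
    costs one [rho]. *)
Lemma iter_shapley_le v w rho c k x : Lip1 d v ->
  (forall y, shapley T v y <= rho + v y) -> (forall y, w y <= v y + c) ->
  iter k (shapley T) w x <= k%:R * rho + v x + c.
Proof.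
move=> vL Sv wv; elim: k x => [x|k IHk x]; first by rewrite mul0r add0r.
rewrite iterS; apply: shapley_le => b; apply: le_trans (IHk _) _.
have := le_trans (shapley_ub x b vL) (Sv x).
by rewrite -natr1; lra.
Qed.

(** A real [sup], with a default value on unbounded families; [iter_le] below makes it genuine. *)
Definition sup_iter_shapley (rho : R) w x : R :=
  sup [set iter k (shapley T) w x - k%:R * rho | k in [set: nat]].

Lemma sup_iter_shapley_le rho w x c :
  (forall k, iter k (shapley T) w x - k%:R * rho <= c) ->
  sup_iter_shapley rho w x <= c.
Proof.
move=> wc; apply: ge_sup => [|_ [k _ <-]]; last exact: wc.
by exists (iter 0 (shapley T) w x - 0%:R * rho), 0%N.
Qed.

Section BoundedIterates.
Variables (rho : R) (w u : hemi_space d -> R).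
Hypothesis w_Lip1 : Lip1 d w.
Hypothesis iter_le :
  forall k x, iter k (shapley T) w x - k%:R * rho <= u x.

Lemma sup_iter_shapley_ub k x :
  iter k (shapley T) w x - k%:R * rho <= sup_iter_shapley rho w x.
Proof.
apply: ub_le_sup; last by exists k.
by exists (u x) => _ [j _ <-]; exact: iter_le.
Qed.

(** The shift [k%:R * rho] cancels in differences, so every term is in [Lip1], and a pointwise
    finite supremum keeps this. *)
Lemma sup_iter_shapley_Lip1 : Lip1 d (sup_iter_shapley rho w).
Proof.
move=> x y; rewrite lerBlDr; apply: sup_iter_shapley_le => k.
have := iter_shapley_Lip1 k w_Lip1 x y.
by have := sup_iter_shapley_ub k y; lra.
Qed.

(** The [k]-th term at [T b x] is at most [rho] plus the [k.+1]-st term at [x]. *)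
Lemma shapley_sup_iter_shapley x :
  shapley T (sup_iter_shapley rho w) x <= rho + sup_iter_shapley rho w x.
Proof.
apply: shapley_le => b; apply: sup_iter_shapley_le => k.
have := shapley_ub x b (iter_shapley_Lip1 k w_Lip1).
by have := sup_iter_shapley_ub k.+1 x; rewrite iterS -natr1; lra.
Qed.

End BoundedIterates.

End ShapleyIteration.

Theorem proposition38 (R : realType) (X : Type) (d : hemimetric R X)
    (x0 : hemi_space d) (B : topologicalType)
    (T : B -> hemi_space d -> hemi_space d)
    (B_neq0 : [set: B] !=set0)
    (B_compact : compact [set: B])
    (T_nonexp : forall b : B, nonexpansive (T b))
    (T_cont : forall x : hemi_space d, continuous (fun b : B => T b x))
    (T_compact : forall K : set (hemi_space d), compact K ->
       compact [set T b x | b in [set: B] & x in K])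
    (rho : R) (rho_value : game_value T x0 = rho%:E) :
  (exists alpha : R, forall k : nat, (1 <= k)%N -> forall x : hemi_space d,
     iter k (shapley T) (fun y => d y x0) x <= k%:R * rho + d x x0 + alpha)
  <->
  (exists2 v : hemi_space d -> R, distance_like x0 v &
     forall x : hemi_space d, shapley T v x <= rho + v x).
Proof.
split=> [[alpha iter_le]|[v [vL [alpha v_ge]] Sv]].
  (* The assumption starts at [k = 1]; taking the absolute value of [alpha] makes the bound hold at
     [k = 0] too. *)
  have iter_le0 k x : iter k (shapley T) (fun y => d y x0) x - k%:R * rho
      <= d x x0 + `|alpha|.
    case: k => [|k]; first by rewrite mul0r subr0 lerDl.
    by have := iter_le k.+1 isT x; have := ler_norm alpha; lra.
  have wL := dist_Lip1 x0.
  exists (sup_iter_shapley T rho (fun y => d y x0)); last first.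
    by move=> x; apply: shapley_sup_iter_shapley iter_le0 x.
  split; first exact: sup_iter_shapley_Lip1 iter_le0.
  exists 0 => x; have := sup_iter_shapley_ub iter_le0 0 x.
  by rewrite mul0r subr0 addr0.
(* The part [- alpha] comes from [d y x0 <= v y - alpha], the part [v x0] from replacing the final
   [v x] by [d x x0 + v x0]. *)
exists (v x0 - alpha) => k _ x.
have w_le y : d y x0 <= v y - alpha by have := v_ge y; lra.
have := iter_shapley_le B_neq0 B_compact T_cont k x vL Sv w_le.
by have := vL x x0; lra.
Qed.
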